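(* For all $n\geq 1$ and $\sigma\in\{132,231\}$, the number of desarrangements of length $n$ avoiding both $312$ and $\sigma$ is $d_n(312,\sigma)=J_{n-1}$, the $(n-1)$st Jacobsthal number.
   Context: Permutations are in one-line notation. An index $i\in[n-1]$ is a descent of $\pi\in\mathfrak{S}_n$ if $\pi_i>\pi_{i+1}$; $i\in[n]$ is an ascent if it is not a descent (so $n$ is always an ascent). A desarrangement is a permutation whose first ascent is even. $d_n(\Pi)$ is the number of desarrangements in $\mathfrak{S}_n$ avoiding every pattern in $\Pi$ ($\pi$ avoids $\sigma$ if no subsequence of $\pi$ has the same relative order as $\sigma$). The Jacobsthal numbers are defined by $J_0=0$, $J_1=1$, $J_n=J_{n-1}+2J_{n-2}$ for $n\ge2$. *)

(* Defs.v *)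
From mathcomp Require Import all_boot all_fingroup.

Set Implicit Arguments.
Unset Strict Implicit.
Unset Printing Implicit Defensive.

(* 'S_n permutes {0, .., n-1}; words use the letters 1, .., n. *)
Definition one_line (n : nat) (s : 'S_n) : seq nat :=
  [seq (s i : nat).+1 | i : 'I_n].

(* Positions are numbered from 1, so the letter at position i is nth 0 w i.-1. *)
Definition descent (w : seq nat) (i : nat) : bool :=
  (1 <= i < size w) && (nth 0 w i < nth 0 w i.-1).

Definition ascent (w : seq nat) (i : nat) : bool :=
  (1 <= i <= size w) && ~~ descent w i.

Definition desarrangement (w : seq nat) : bool :=
  [exists i : 'I_(size w).+1,
     [&& ascent w i, [forall j : 'I_(size w).+1, (j < i) ==> ~~ ascent w j]
       & ~~ odd i]].

(* f lists, in increasing order, the positions (from 0) of a subsequence of w. *)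
Definition contains (w p : seq nat) : bool :=
  [exists f : {ffun 'I_(size p) -> 'I_(size w)},
     [forall a : 'I_(size p), forall b : 'I_(size p),
        ((a < b) ==> (f a < f b)) &&
        ((nth 0 w (f a) < nth 0 w (f b)) == (nth 0 p a < nth 0 p b))]].

Definition avoids (w p : seq nat) : bool := ~~ contains w p.

Definition d (n : nat) (Pi : seq (seq nat)) : nat :=
  #|[set s : 'S_n | desarrangement (one_line s) && all (avoids (one_line s)) Pi]|.

Fixpoint jacobsthal (n : nat) : nat :=
  match n with
  | 0 => 0
  | 1 => 1
  | (m.+1 as k).+1 => jacobsthal k + 2 * jacobsthal m
  end.

(* Main.v *)
Require Import Defs.
From mathcomp Require Import all_boot all_fingroup.
From mathcomp Require Import zify.

(** Every permutation of n + 1 letters arises uniquely from one of n letters by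
    prepending a letter and shifting up the letters that are at least as large.
    If b is the letter that follows the new first letter a, then avoidance of
    312 is preserved iff a <= b + 1, that of 132 iff b <= a + 1, and that of
    312 and 231 together iff a = b + 1 or a = 1.  So for either sigma each
    avoider has exactly two children, only one of which, a = b + 1, starts with
    a descent.  That child's first ascent is one more than its parent's, the
    other child's is 1.  Hence there are 2 ^ n avoiders of length n + 1, and the
    desarrangements of lengths n + 1 and n + 2 among the avoiders number 2 ^ n
    in all, which is J_n + J_(n + 1). *)

Set Implicit Arguments.
Unset Strict Implicit.
Unset Printing Implicit Defensive.

Lemma ltn_bump h : {mono bump h : x y / x < y}.
Proof. by move=> x y; rewrite !ltnNge leq_bump2. Qed.

Lemma subseq_nthP (T : eqType) (x0 : T) (t s : seq T) :
  reflect
    (exists2 l, sorted ltn l && all (gtn (size s)) l & t = map (nth x0 s) l)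
    (subseq t s).
Proof.
apply: (iffP idP) => [/subseqP[m _ ->]|[l /andP[l_sorted l_lt] ->]].
  exists (mask m (iota 0 (size s))); last first.
    by rewrite map_mask -/(mkseq _ _) mkseq_nth.
  rewrite (sorted_mask ltn_trans) ?iota_ltn_sorted //=.
  by apply/allP => i /mem_mask; rewrite mem_iota.
have -> : l = filter (mem l) (iota 0 (size s)).
  apply: (irr_sorted_eq ltn_trans ltnn) => // [|i].
    exact: (sorted_filter ltn_trans _ (iota_ltn_sorted _ _)).
  rewrite mem_filter mem_iota /=; case: (boolP (i \in l)) => //=.
  by move/(allP l_lt).
by rewrite -[s in subseq _ s](mkseq_nth x0) map_subseq ?filter_subseq.
Qed.

Definition order_iso (u v : seq nat) : bool :=
  (size u == size v) &&
  all2rel (fun p q => (p.1 < q.1) == (p.2 < q.2)) (zip u v).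

Lemma order_isoP (u v : seq nat) :
  reflect
    (size u = size v /\ forall i j, i < size v -> j < size v ->
       (nth 0 u i < nth 0 u j) = (nth 0 v i < nth 0 v j))
    (order_iso u v).
Proof.
apply: (iffP andP) => [[/eqP eq_sz /allrelP uv]|[eq_sz uv]].
  split=> // i j lti ltj.
  have nth_in k : k < size v -> (nth 0 u k, nth 0 v k) \in zip u v.
    by move=> ltk; rewrite -nth_zip // mem_nth // size_zip eq_sz minnn.
  by have /eqP := uv _ _ (nth_in i lti) (nth_in j ltj).
split; first exact/eqP.
apply/allrelP => p q /(nthP (0, 0))[i lti <-] /(nthP (0, 0))[j ltj <-].
rewrite size_zip eq_sz minnn in lti ltj.
by rewrite !nth_zip //= uv.
Qed.

Lemma order_iso_map (f : nat -> nat) (u v : seq nat) :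
  {mono f : x y / x < y} -> order_iso (map f u) v = order_iso u v.
Proof.
move=> fM; apply/order_isoP/order_isoP; rewrite size_map => -[eq_sz uv];
  by split=> // i j lti ltj; rewrite -uv // !(nth_map 0) ?eq_sz // fM.
Qed.

Lemma order_iso3 (a b c x y z : nat) :
  order_iso [:: a; b; c] [:: x; y; z] =
  [&& (a < b) == (x < y), (b < a) == (y < x), (a < c) == (x < z),
      (c < a) == (z < x), (b < c) == (y < z) & (c < b) == (z < y)].
Proof. by rewrite /order_iso /allrel /= !ltnn; lia. Qed.

Lemma containsP (w p : seq nat) :
  reflect (exists2 t, subseq t w & order_iso t p) (contains w p).
Proof.
apply: (iffP existsP) => [[f fP]|[t /(subseq_nthP 0)[l]]]; last first.
  case/andP=> l_sorted l_lt -> {t} /order_isoP[]; rewrite size_map => size_l lP.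
  have lt_l (a : 'I_(size p)) : nth 0 l a < size w.
    by apply: (allP l_lt); rewrite mem_nth ?size_l.
  exists [ffun a => Ordinal (lt_l a)].
  apply/forallP => a; apply/forallP => b; rewrite !ffunE /=.
  rewrite -lP // !(nth_map 0) ?size_l // eqxx andbT; apply/implyP.
  by apply: (sorted_ltn_nth ltn_trans); rewrite ?inE ?size_l.
have {}fP a b := andP (forallP (forallP fP a) b).
pose l := [seq (f a : nat) | a <- enum 'I_(size p)].
have size_l : size l = size p by rewrite size_map size_enum_ord.
have nth_l (a : 'I_(size p)) : nth 0 (map (nth 0 w) l) a = nth 0 w (f a).
  by rewrite (nth_map 0) ?size_l // (nth_map a) ?size_enum_ord ?nth_ord_enum.
exists (map (nth 0 w) l).
  apply/(subseq_nthP 0); exists l => //; apply/andP; split.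
    apply: (@homo_sorted _ _ _ (relpre val ltn)) => [a b|].
      by case: (fP a b) => /implyP.
    by rewrite -sorted_map val_enum_ord iota_ltn_sorted.
  by apply/allP => _ /mapP[a _ ->]; apply: ltn_ord.
apply/order_isoP; rewrite size_map size_l; split=> // i j lti ltj.
rewrite (nth_l (Ordinal lti)) (nth_l (Ordinal ltj)).
by case: (fP (Ordinal lti) (Ordinal ltj)) => _ /eqP.
Qed.

Lemma avoids_map (f : nat -> nat) (w p : seq nat) :
  {mono f : x y / x < y} -> avoids (map f w) p = avoids w p.
Proof.
move=> fM; congr (~~ _).
apply/containsP/containsP => [[t /subseqP[m _ ->]]|[t tw tp]].
  rewrite -map_mask order_iso_map // => mp.
  by exists (mask m w); rewrite ?mask_subseq.
by exists (map f t); rewrite ?map_subseq ?order_iso_map.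
Qed.

Lemma contains_consP (a x : nat) (w p : seq nat) :
  reflect
    (contains w (x :: p) \/ exists2 t, subseq t w & order_iso (a :: t) (x :: p))
    (contains (a :: w) (x :: p)).
Proof.
apply: (iffP idP) => [/containsP[[|b t] //=]|[/containsP[t tw tp]|[t tw tp]]].
- case: eqP => [->|_] tw tp; first by right; exists t.
  by left; apply/containsP; exists (b :: t).
- by apply/containsP; exists t; rewrite ?(subseq_trans tw) ?subseq_cons.
by apply/containsP; exists (a :: t); rewrite //= eqxx.
Qed.

Lemma lt_size_avoids (w p : seq nat) : size w < size p -> avoids w p.
Proof.
move=> lt_wp; apply/negP => /containsP[t /size_subseq tw /order_isoP[tp _]].
by rewrite tp leqNgt lt_wp in tw.
Qed.

(* An occurrence in a :: b :: w that uses a either uses b as well, or still is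
   one when a is replaced by b. *)
Lemma avoids3_cons2 (a b x y z : nat) (w : seq nat) (safe : bool) :
  let occurs c u v := order_iso [:: c; u; v] [:: x; y; z] in
  (~~ safe -> exists2 v, v \in w & occurs a b v) ->
  (safe -> {in w, forall v, ~~ occurs a b v}) ->
  (safe -> {in w &, forall u v, occurs a u v -> occurs b u v}) ->
  avoids (a :: b :: w) [:: x; y; z] = avoids (b :: w) [:: x; y; z] && safe.
Proof.
move=> occurs unsafe_ab safe_ab swap_ab; apply/idP/andP => [av|[av is_safe]].
  split; first by apply: contra av => bw; apply/contains_consP; left.
  apply: contraT => /unsafe_ab[v vw abv]; case/negP: av.
  by apply/contains_consP; right; exists [:: b; v]; rewrite //= eqxx sub1seq.
apply: contra av => /contains_consP[//|[t tbw]] /[dup] /order_isoP[[size_t] _].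
case: t tbw size_t => [|u [|v []]] //= tbw _.
case: eqP tbw => [->|_] uvw auv.
  by have /(safe_ab is_safe)/negP[] : v \in w by rewrite -sub1seq.
apply/contains_consP; right; exists [:: u; v] => //; apply: swap_ab => //;
  by apply: (mem_subseq uvw); rewrite !inE eqxx ?orbT.
Qed.

Section PermutationWord.

Variables (n a b : nat) (w : seq nat).
Hypothesis abw_perm : perm_eq (a :: b :: w) (iota 1 n).

Lemma mem_perm_iota_cons2 v :
  (v \in w) = [&& 0 < v <= n, v != a & v != b].
Proof.
have := perm_mem abw_perm v; rewrite !inE mem_iota add1n ltnS => <-.
have : uniq (a :: b :: w) by rewrite (perm_uniq abw_perm) iota_uniq.
case/and3P; rewrite inE negb_or => /andP[_ aw] bw _.
case: eqP => [->|_]; first by rewrite (negPf aw) andbF.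
by case: eqP => [->|_]; rewrite ?(negPf bw) ?andbT ?andbF.
Qed.

Lemma perm_iota_cons2_range : [/\ 0 < a <= n, 0 < b <= n & a != b].
Proof.
have range v : (0 < v <= n) = (v \in a :: b :: w).
  by rewrite (perm_mem abw_perm) mem_iota add1n ltnS.
have : uniq (a :: b :: w) by rewrite (perm_uniq abw_perm) iota_uniq.
by rewrite !range !inE !eqxx orbT /= negb_or => /andP[/andP[ab]].
Qed.

Lemma avoids312_cons2 :
  avoids (a :: b :: w) [:: 3; 1; 2] =
  avoids (b :: w) [:: 3; 1; 2] && (a <= b.+1).
Proof.
have [a_le b_le ab] := perm_iota_cons2_range.
apply: avoids3_cons2 => [unsafe|safe v|safe u v].
- by exists b.+1; rewrite ?mem_perm_iota_cons2 ?order_iso3 /=; lia.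
- by rewrite mem_perm_iota_cons2 order_iso3 /=; lia.
- by rewrite !mem_perm_iota_cons2 !order_iso3 /=; lia.
Qed.

Lemma avoids132_cons2 :
  avoids (a :: b :: w) [:: 1; 3; 2] =
  avoids (b :: w) [:: 1; 3; 2] && (b <= a.+1).
Proof.
have [a_le b_le ab] := perm_iota_cons2_range.
apply: avoids3_cons2 => [unsafe|safe v|safe u v].
- by exists a.+1; rewrite ?mem_perm_iota_cons2 ?order_iso3 /=; lia.
- by rewrite mem_perm_iota_cons2 order_iso3 /=; lia.
- by rewrite !mem_perm_iota_cons2 !order_iso3 /=; lia.
Qed.

Lemma avoids231_cons2 :
  a <= b.+1 ->
  avoids (a :: b :: w) [:: 2; 3; 1] =
  avoids (b :: w) [:: 2; 3; 1] && ((a == b.+1) || (a == 1)).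
Proof.
move=> a_le_b1; have [a_le b_le ab] := perm_iota_cons2_range.
apply: avoids3_cons2 => [unsafe|safe v|safe u v].
- by exists 1; rewrite ?mem_perm_iota_cons2 ?order_iso3 /=; lia.
- by rewrite mem_perm_iota_cons2 order_iso3 /=; lia.
- by rewrite !mem_perm_iota_cons2 !order_iso3 /=; lia.
Qed.

End PermutationWord.

Fixpoint first_ascent (w : seq nat) : nat :=
  match w with
  | a :: (b :: _) as w' => if b < a then (first_ascent w').+1 else 1
  | _ => 1
  end.

Lemma first_ascent_cons2 (a b : nat) (w : seq nat) :
  first_ascent (a :: b :: w) = if b < a then (first_ascent (b :: w)).+1 else 1.
Proof. by []. Qed.

Lemma first_ascent_gt0 (w : seq nat) : 0 < first_ascent w.
Proof. by case: w => [|a [|b w]] //=; case: ifP. Qed.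

Lemma ascent_consS (a : nat) (w : seq nat) (i : nat) :
  0 < i -> ascent (a :: w) i.+1 = ascent w i.
Proof. by case: i => [|i] // _; rewrite /ascent /descent /= !ltnS. Qed.

Lemma ascent_first_ascent (w : seq nat) :
  0 < size w -> ascent w (first_ascent w).
Proof.
elim: w => [|a [|b w] IHw] // _.
rewrite first_ascent_cons2; case: ifP => [_|ba].
  by rewrite ascent_consS ?IHw ?first_ascent_gt0.
by rewrite /ascent /descent /= ba.
Qed.

Lemma ascent_ge_first_ascent (w : seq nat) (i : nat) :
  ascent w i -> first_ascent w <= i.
Proof.
elim: w i => [|a [|b w] IHw] [|i] //.
rewrite first_ascent_cons2; case: ifP => // ba.
case: i => [|i]; first by rewrite /ascent /descent /= ba.
by rewrite ascent_consS // => /IHw.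
Qed.

Lemma desarrangementE (w : seq nat) :
  desarrangement w = ~~ odd (first_ascent w).
Proof.
have [/eqP/nilP->|w_gt0] := posnP (size w).
  by apply/existsP => -[[[|i] lti]].
have asc := ascent_first_ascent w_gt0.
have lt_sz : first_ascent w < (size w).+1 by case/andP: asc => /andP[].
apply/existsP/idP => [[i /and3P[asc_i /forallP min_i even_i]]|even_w].
  suff <- : i = first_ascent w :> nat by [].
  apply/eqP; rewrite eqn_leq ascent_ge_first_ascent // andbT leqNgt.
  by apply: contraL asc => /(implyP (min_i (Ordinal lt_sz))).
exists (Ordinal lt_sz); rewrite /= asc even_w andbT.
apply/forallP => j; apply/implyP; rewrite ltnNge; apply: contra.
exact: ascent_ge_first_ascent.
Qed.

Lemma desarrangement_cons2 (a b : nat) (w : seq nat) :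
  desarrangement (a :: b :: w) = (b < a) && ~~ desarrangement (b :: w).
Proof. by rewrite !desarrangementE first_ascent_cons2; case: ifP. Qed.

Lemma desarrangement_map (f : nat -> nat) (w : seq nat) :
  {mono f : x y / x < y} -> desarrangement (map f w) = desarrangement w.
Proof.
move=> fM; rewrite !desarrangementE; congr (~~ odd _).
elim: w => [|a [|b w] IHw] //.
by rewrite first_ascent_cons2 -IHw -fM.
Qed.

Lemma lift_perm_inj2 n (i : 'I_n.+1) :
  injective (fun sc : 'S_n * 'I_n.+1 => lift_perm i sc.2 sc.1).
Proof.
move=> [s c] [s' c'] /= eq_sc.
have eq_c : c = c' by rewrite -(lift_perm_id i c s) eq_sc lift_perm_id.
rewrite -{}eq_c in eq_sc *; congr (_, _); apply/permP => k.
by apply: (@lift_inj _ c); rewrite -!(lift_perm_lift i) eq_sc.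
Qed.

Lemma card_lift_perm n (i : 'I_n.+1) (B : {set 'S_n.+1}) :
  #|B| = \sum_(s : 'S_n) #|[set c | lift_perm i c s \in B]|.
Proof.
have lift_bij : bijective (fun sc : 'S_n * 'I_n.+1 => lift_perm i sc.2 sc.1).
  apply: inj_card_bij; first exact: lift_perm_inj2.
  by rewrite card_prod !card_Sn card_ord factS mulnC.
rewrite -sum1_card (reindex _ (onW_bij _ lift_bij)) /=.
under [RHS]eq_bigr do rewrite -sum1dep_card.
by rewrite pair_big_dep.
Qed.

Lemma perm_one_line n (s : 'S_n) : perm_eq (one_line s) (iota 1 n).
Proof.
have s_enum : perm_eq (map s (enum 'I_n)) (enum 'I_n).
  apply: uniq_perm => [||i]; rewrite ?(map_inj_uniq perm_inj) ?enum_uniq //.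
  by rewrite -(permKV s i) mem_map ?mem_enum //; apply: perm_inj.
rewrite /one_line /image_mem -(addn0 1) iotaDl -val_enum_ord -map_comp.
rewrite (map_comp (fun i : 'I_n => i.+1) s).
exact: perm_map.
Qed.

Lemma one_line_lift0 n (c : 'I_n.+1) (s : 'S_n) :
  one_line (lift_perm ord0 c s) = c.+1 :: map (bump c.+1) (one_line s).
Proof.
rewrite /one_line /image_mem enum_ordSl /= lift_perm_id -!map_comp.
congr (_ :: _); apply: eq_map => k /=.
by rewrite lift_perm_lift /= /bump !ltnS addnS.
Qed.

Lemma map_bump_one_line n (c : nat) (s : 'S_n.+1) :
  exists w, map (bump c) (one_line s) = bump c (s ord0).+1 :: w.
Proof. by rewrite /one_line /image_mem enum_ordSl; eexists. Qed.

Lemma desarrangement_lift0 n (c : 'I_n.+2) (s : 'S_n.+1) :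
  desarrangement (one_line (lift_perm ord0 c s)) =
  (s ord0 < c) && ~~ desarrangement (one_line s).
Proof.
rewrite one_line_lift0 -(desarrangement_map (one_line s) (ltn_bump c.+1)).
have [w ->] := map_bump_one_line c.+1 s; rewrite desarrangement_cons2.
by congr andb; rewrite /bump; lia.
Qed.

Lemma avoids_312_132_lift0 n (c : 'I_n.+2) (s : 'S_n.+1) :
  let Pi := [:: [:: 3; 1; 2]; [:: 1; 3; 2]] in
  all (avoids (one_line (lift_perm ord0 c s))) Pi =
  all (avoids (one_line s)) Pi &&
  ((c == s ord0 :> nat) || (c == (s ord0).+1 :> nat)).
Proof.
rewrite /= !andbT.
have := perm_one_line (lift_perm ord0 c s); rewrite one_line_lift0.
rewrite -!(avoids_map (one_line s) _ (ltn_bump c.+1)).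
have [w ->] := map_bump_one_line c.+1 s => cw_perm.
rewrite (avoids312_cons2 cw_perm) (avoids132_cons2 cw_perm) andbACA.
by congr andb; rewrite /bump; lia.
Qed.

Lemma avoids_312_231_lift0 n (c : 'I_n.+2) (s : 'S_n.+1) :
  let Pi := [:: [:: 3; 1; 2]; [:: 2; 3; 1]] in
  all (avoids (one_line (lift_perm ord0 c s))) Pi =
  all (avoids (one_line s)) Pi &&
  ((c == 0 :> nat) || (c == (s ord0).+1 :> nat)).
Proof.
rewrite /= !andbT.
have := perm_one_line (lift_perm ord0 c s); rewrite one_line_lift0.
rewrite -!(avoids_map (one_line s) _ (ltn_bump c.+1)).
have [w ->] := map_bump_one_line c.+1 s => cw_perm.
rewrite (avoids312_cons2 cw_perm).
have [cb|bc] := leqP c.+1 (bump c.+1 (s ord0).+1).+1; last first.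
  by rewrite andbF; symmetry; apply/negbTE; move: bc; rewrite /bump; lia.
rewrite (avoids231_cons2 cw_perm cb) andbT andbA.
by congr andb; rewrite /bump; lia.
Qed.

Lemma jacobsthal_addS n : jacobsthal n + jacobsthal n.+1 = 2 ^ n.
Proof. by elim: n => // n IHn; rewrite expnS -IHn /=; lia. Qed.

Section TwoChildren.

Variables (P : pred (seq nat)) (u : nat -> nat).
Hypothesis u_le : forall h, u h <= h.
Hypothesis P_lift0 : forall n (c : 'I_n.+2) (s : 'S_n.+1),
  P (one_line (lift_perm ord0 c s)) =
  P (one_line s) && ((c == u (s ord0) :> nat) || (c == (s ord0).+1 :> nat)).

Let members n : {set 'S_n} := [set s | P (one_line s)].
Let desarrangements n : {set 'S_n} := [set s | desarrangement (one_line s)].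

Lemma card_members_S n : #|members n.+2| = 2 * #|members n.+1|.
Proof.
rewrite (card_lift_perm ord0) mulnC -sum_nat_const [RHS]big_mkcond.
apply: eq_bigr => s _; rewrite inE; case: ifP => Ps; last first.
  by apply: eq_card0 => c; rewrite !inE P_lift0 Ps.
have lt_u : u (s ord0) < n.+2 by rewrite ltnW // ltnS (leq_ltn_trans (u_le _)).
rewrite (_ : [set c | _] = [set Ordinal lt_u; lift ord0 (s ord0)]).
  by rewrite cards2 -val_eqE /= /bump add1n ltn_eqF // ltnS u_le.
by apply/setP => c; rewrite !inE P_lift0 Ps.
Qed.

Lemma card_desarrangements_S n :
  #|members n.+2 :&: desarrangements n.+2| =
  #|members n.+1 :\: desarrangements n.+1|.
Proof.
rewrite (card_lift_perm ord0) -sum1_card [RHS]big_mkcond.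
apply: eq_bigr => s _; rewrite -(cards1 (lift ord0 (s ord0))) !inE.
case: ifP => [/andP[nDs Ps]|not_Ps]; last first.
  apply: eq_card0 => c; rewrite !inE P_lift0 desarrangement_lift0.
  by move: not_Ps; case: P => //=; case: desarrangement; rewrite ?andbF.
apply: eq_card => c; rewrite !inE P_lift0 desarrangement_lift0 Ps nDs andbT /=.
rewrite -val_eqE /= /bump.
by have := u_le (s ord0); lia.
Qed.

Lemma card_desarrangements_jacobsthal n :
  #|[set s : 'S_1 | P (one_line s)]| = 1 ->
  #|[set s : 'S_n.+1 | desarrangement (one_line s) && P (one_line s)]| =
  jacobsthal n.
Proof.
move=> card1.
have -> m : [set s : 'S_m | desarrangement (one_line s) && P (one_line s)] =
            members m :&: desarrangements m.
  by apply/setP => s; rewrite !inE andbC.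
have card_members m : #|members m.+1| = 2 ^ m.
  by elim: m => // m IHm; rewrite card_members_S IHm expnS.
elim: n => [|n IHn].
  apply: eq_card0 => s; rewrite !inE desarrangementE.
  have := perm_size (perm_one_line s).
  by case: (one_line s) => [|a [|b w]] //; rewrite andbF.
apply/eqP; rewrite card_desarrangements_S -(eqn_add2l (jacobsthal n)).
by rewrite -{1}IHn cardsID card_members jacobsthal_addS.
Qed.

End TwoChildren.

Lemma card_avoiders1 (Pi : seq (seq nat)) :
  all (fun p => 1 < size p) Pi ->
  #|[set s : 'S_1 | all (avoids (one_line s)) Pi]| = 1.
Proof.
move=> Pi_gt1; rewrite -[RHS]/(1`!) -card_Sn; apply: eq_card => s.
rewrite !inE; apply: sub_all Pi_gt1 => p p_gt1.
by rewrite lt_size_avoids // (perm_size (perm_one_line s)).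
Qed.

Theorem theorem3p18 (n : nat) (sigma : seq nat) :
  1 <= n ->
  sigma \in [:: [:: 1; 3; 2]; [:: 2; 3; 1]] ->
  d n [:: [:: 3; 1; 2]; sigma] = jacobsthal n.-1.
Proof.
case: n => // n _; rewrite !inE => /orP[]/eqP->.
- apply: (@card_desarrangements_jacobsthal
            (fun w => all (avoids w) _) id) => //.
  + exact: avoids_312_132_lift0.
  + exact: card_avoiders1.
- apply: (@card_desarrangements_jacobsthal
            (fun w => all (avoids w) _) (fun=> 0)) => //.
  + exact: avoids_312_231_lift0.
  + exact: card_avoiders1.
Qed.
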